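(* Let $q$ be a quiddity sequence of length $n$ of a periodic infinite frieze of positive integers. Let $\hat q$ be a quiddity sequence obtained from $q$ by performing an $n$-gluing, and let $\check q$ be a quiddity sequence obtained from $q$ by performing an $n$-cutting (if defined). Then $s_q=s_{\hat q}$ and $s_q=s_{\check q}$.
   Context: An infinite frieze of positive integers is an array $(m_{i,j})$, indexed by $i\in\mathbb{Z}$ and $j\ge i-2$, with $m_{i,i-2}=0$, $m_{i,i-1}=1$, with $m_{i,j}$ a positive integer for $j\ge i-1$, and with $m_{i,j}m_{i+1,j+1}-m_{i,j+1}m_{i+1,j}=1$ for all $i$ and all $j\ge i-1$. Its quiddity row is $(a_i)_{i\in\mathbb{Z}}$, $a_i=m_{i,i}$, which determines the frieze. The frieze is $n$-periodic if $m_{i+n,j+n}=m_{i,j}$ for all entries; then $q=(a_1,\dots,a_n)$ is a quiddity sequence of length $n$ of the frieze ($n$ need not be the minimal period). For a quiddity sequence $q$ of length $n$ set $s_q:=m_{1,n}-m_{2,n-1}$, where $(m_{i,j})$ is the frieze with quiddity sequence $q$. Let $q=(a_1,\dots,a_n)$ be a quiddity sequence of length $n$; indices are read cyclically modulo $n$. $n$-gluing (above a pair $(a_i,a_{i+1})$): if $n=1$, $\hat q=(a_1+2,1)$; if $n\ge2$, $\hat q=(a_1,\dots,a_{i-1},a_i+1,1,a_{i+1}+1,a_{i+2},\dots,a_n)$, which for $i=n$ is read as $(a_1+1,a_2,\dots,a_{n-1},a_n+1,1)$. $n$-cutting (above an entry $a_i=1$, defined whenever such an entry exists): if $n=2$,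 $\check q=(a_{i+1}-2)$; if $n\ge 3$, $\check q=(a_1,\dots,a_{i-2},a_{i-1}-1,a_{i+1}-1,a_{i+2},\dots,a_n)$, i.e. the entry $a_i=1$ is deleted and its two cyclic neighbours are decreased by $1$. It is known that the outcomes $\hat q$ and $\check q$ are again quiddity sequences (of lengths $n+1$ and $n-1$) of periodic infinite friezes of positive integers, and that no quiddity sequence of an infinite frieze of positive integers has two (cyclically) consecutive ones. *)

(* Defs.v *)
From Stdlib Require Import ClassicalEpsilon.
From mathcomp Require Import all_boot all_order all_algebra.

Set Implicit Arguments.
Unset Strict Implicit.
Unset Printing Implicit Defensive.
Import Order.TTheory GRing.Theory Num.Theory.
Local Open Scope ring_scope.

(* The array (m_{i,j}) is only indexed by j >= i - 2.  It is represented by a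
   total function whose values outside this range are unconstrained and never
   used. *)
Definition infinite_frieze (m : int -> int -> int) : Prop :=
  [/\ forall i, m i (i - 2) = 0,
      forall i, m i (i - 1) = 1,
      forall i j, i - 1 <= j -> 0 < m i j
    & forall i j, i - 1 <= j ->
        m i j * m (i + 1) (j + 1) - m i (j + 1) * m (i + 1) j = 1].

Definition periodic_frieze (n : nat) (m : int -> int -> int) : Prop :=
  forall i j, i - 2 <= j -> m (i + n%:Z) (j + n%:Z) = m i j.

(* The sequence (a_1, ..., a_n) is a list q with a_{k+1} = q`_k; its length n
   is a period of the frieze, not necessarily the minimal one. *)
Definition frieze_with_quiddity (q : seq int) (m : int -> int -> int) : Prop :=
  [/\ (0 < size q)%N,
      infinite_frieze m,
      periodic_frieze (size q) m
    & forall k : nat, (k < size q)%N -> q`_k = m k.+1%:Z k.+1%:Z].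

Definition quiddity_sequence (q : seq int) : Prop :=
  exists m, frieze_with_quiddity q m.

(* When q is a quiddity sequence, the entries m_{i,j} with j >= i - 2 of a frieze
   with quiddity sequence q are uniquely determined by q, so the choice made here
   only concerns the irrelevant values at j < i - 2. *)
Definition frieze_of (q : seq int) : int -> int -> int :=
  epsilon (inhabits (fun _ _ : int => 0)) (frieze_with_quiddity q).

Definition s_of (q : seq int) : int :=
  let m := frieze_of q in
  let n := (size q)%:Z in
  m 1 n - m 2 (n - 1).

(* Gluing above (a_i, a_{i+1}): n = 1; then n >= 2 and i < n; then n >= 2 and
   i = n, i.e. above (a_n, a_1). *)
Inductive gluing : seq int -> seq int -> Prop :=
| gluing_one a :
    gluing [:: a] [:: a + 2; 1]
| gluing_inner u a b v :
    gluing (u ++ [:: a; b] ++ v) (u ++ [:: a + 1; 1; b + 1] ++ v)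
| gluing_last a u b :
    gluing (a :: u ++ [:: b]) (a + 1 :: u ++ [:: b + 1; 1]).

(* Cutting above an entry a_i = 1: n = 2 (with i = 1 or 2); then n >= 3 with
   1 < i < n, i = 1 and i = n. *)
Inductive cutting : seq int -> seq int -> Prop :=
| cutting_two_first a :
    cutting [:: 1; a] [:: a - 2]
| cutting_two_last a :
    cutting [:: a; 1] [:: a - 2]
| cutting_inner u a b v :
    cutting (u ++ [:: a; 1; b] ++ v) (u ++ [:: a - 1; b - 1] ++ v)
| cutting_first b u a :
    cutting [:: 1, b & u ++ [:: a]] (b - 1 :: u ++ [:: a - 1])
| cutting_last b u a :
    cutting (b :: u ++ [:: a; 1]) (b - 1 :: u ++ [:: a - 1]).

(* Main.v *)
Require Import Defs.
From mathcomp Require Import all_boot all_order all_algebra.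
From mathcomp Require Import zify ring lra.
From Stdlib Require Import ClassicalEpsilon.

Set Implicit Arguments.
Unset Strict Implicit.
Unset Printing Implicit Defensive.
Import Order.TTheory GRing.Theory Num.Theory.
Local Open Scope ring_scope.

(** Write an infinite frieze as m_{i,j} = det(v_{i-1}, v_{j+1}) for a sequence
    of vectors v : Z -> Z^2 with det(v_i, v_{i+1}) = 1 and det(v_i, v_j) > 0 for
    i < j; the quiddity entry a_i is the coefficient of
    v_{i+1} + v_{i-1} = a_i v_i.  Gluing inserts the mediant v_j + v_{j+1}
    between two consecutive vectors, periodically, and cutting deletes a vector
    which is the sum of its neighbours; neither operation affects positivity.
    By the rotation invariance of s_q = det(v_0, v_{n+1}) - det(v_1, v_n) it is
    enough to glue above (a_n, a_1).  This replaces v_0 by v_0 + v_1 and v_n by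
    v_n + v_{n+1}, and the two new terms det(v_1, v_{n+1}) cancel. *)

(** * Determinants of sequences of plane vectors *)

Definition vdet (x y : int -> int) (i j : int) : int := x i * y j - x j * y i.

Lemma vdet_anti x y i j : vdet x y i j = - vdet x y j i.
Proof. rewrite /vdet; ring. Qed.

Lemma vdet_diag x y i : vdet x y i i = 0.
Proof. rewrite /vdet; ring. Qed.

Definition unimodular (x y : int -> int) : Prop :=
  forall i, vdet x y i (i + 1) = 1.

Lemma unimodularB x y i : unimodular x y -> vdet x y (i - 1) i = 1.
Proof. by move=> h; rewrite -[RHS](h (i - 1)) subrK. Qed.

(** Cramer's relation det(v_{i-1}, v_i) v_{i+1} + det(v_i, v_{i+1}) v_{i-1} = det(v_{i-1}, v_{i+1})
    v_i, in which both determinants on the left are 1. *)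
Lemma unimodular_recl x y i : unimodular x y ->
  x (i + 1) + x (i - 1) = vdet x y (i - 1) (i + 1) * x i.
Proof.
move=> h; have := h i; have := unimodularB i h; rewrite /vdet => e1 e2.
have -> : x (i + 1) + x (i - 1) =
  x (i + 1) * (x (i - 1) * y i - x i * y (i - 1)) +
  x (i - 1) * (x i * y (i + 1) - x (i + 1) * y i) by rewrite e1 e2; ring.
ring.
Qed.

Lemma unimodular_recr x y i : unimodular x y ->
  y (i + 1) + y (i - 1) = vdet x y (i - 1) (i + 1) * y i.
Proof.
move=> h; have := h i; have := unimodularB i h; rewrite /vdet => e1 e2.
have -> : y (i + 1) + y (i - 1) =
  y (i + 1) * (x (i - 1) * y i - x i * y (i - 1)) +
  y (i - 1) * (x i * y (i + 1) - x (i + 1) * y i) by rewrite e1 e2; ring.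
ring.
Qed.

Lemma unimodular_vdet_rec x y i j : unimodular x y ->
  vdet x y i (j + 1) + vdet x y i (j - 1) =
  vdet x y (j - 1) (j + 1) * vdet x y i j.
Proof.
move=> h; have ex := unimodular_recl j h; have ey := unimodular_recr j h.
have -> : vdet x y i (j + 1) + vdet x y i (j - 1) =
   x i * (y (j + 1) + y (j - 1)) - (x (j + 1) + x (j - 1)) * y i.
  by rewrite /vdet; ring.
by rewrite ex ey /vdet; ring.
Qed.

(** * Friezes as determinant arrays *)

Lemma second_order_solution (a : int -> int) (p r : int) :
  exists x : int -> int, [/\ x 0 = p, x 1 = r
    & forall j, x (j + 1) = a j * x j - x (j - 1)].
Proof.
(* [fwd k] holds (x_k, x_{k+1}) and [bwd k] holds (x_{-k}, x_{1-k}). *)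
pose fwd := fix fwd (k : nat) : int * int := if k is k'.+1 then
  let: (u, v) := fwd k' in (v, a k'.+1%:Z * v - u) else (p, r).
pose bwd := fix bwd (k : nat) : int * int := if k is k'.+1 then
  let: (u, v) := bwd k' in (a (- k'%:Z) * u - v, u) else (p, r).
have fwdS k : (fwd k.+1).1 = (fwd k).2 by rewrite /=; case: (fwd k).
have bwdS k : (bwd k.+1).2 = (bwd k).1 by rewrite /=; case: (bwd k).
exists (fun j => match j with Posz k => (fwd k).1 | Negz k => (bwd k.+1).1 end).
split=> // -[[|k]|k].
- by rewrite -[RHS]/(a 0 * p - (a 0 * p - r)) opprB addrC subrK.
- have -> : Posz k.+1 + 1 = Posz k.+2 by lia.
  have -> : Posz k.+1 - 1 = Posz k by lia.
  by rewrite !fwdS /=; case: (fwd k).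
- have -> : Negz k - 1 = Negz k.+1 by lia.
  have e : a (Negz k) = a (- k.+1%:Z) by [].
  have -> : (bwd k.+2).1 = a (Negz k) * (bwd k.+1).1 - (bwd k.+1).2.
    by rewrite e /=; case: (bwd k).
  case: k e => [|k] e; first by rewrite bwdS /=; ring.
  have -> : Negz k.+1 + 1 = Negz k by lia.
  rewrite bwdS; ring.
Qed.

(* The vectors are v_j = (x j, y j).  As q`_k = a_{k+1}, this entry is read off
   the neighbours of v_{k+1}. *)
Definition realizes (x y : int -> int) (q : seq int) : Prop :=
  [/\ (0 < size q)%N, unimodular x y,
      forall i j, i < j -> 0 < vdet x y i j,
      forall i j, vdet x y (i + (size q)%:Z) (j + (size q)%:Z) = vdet x y i j
    & forall k : nat, (k < size q)%N -> q`_k = vdet x y k%:Z (k%:Z + 2)].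

(** Induction on decreasing i from i = j + 1. Equating two determinant rules in rows i - 1, i gives
    m_{i-1,j}(m_{i,j+1} + m_{i,j-1}) = m_{i,j}(m_{i-1,j+1} + m_{i-1,j-1}); the induction hypothesis
    rewrites the left side, and the positive m_{i,j} cancels. *)
Lemma frieze_rec (m : int -> int -> int) (i j : int) :
  infinite_frieze m -> i - 1 <= j ->
  m i (j + 1) + m i (j - 1) = m (j + 1) (j + 1) * m i j.
Proof.
case=> m0 m1 mpos mdet le_ij.
have [t ->] : exists t : nat, i = j + 1 - t%:Z.
  by exists (absz (j + 1 - i)%R); lia.
elim: t => [|t IH] {i le_ij}.
  have := m0 (j + 1); have := m1 (j + 1).
  have -> : j + 1 - 2 = j - 1 by lia.
  by rewrite addrK subr0 => -> ->; rewrite addr0 mulr1.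
set i := _ - _ in IH *.
have -> : j + 1 - t.+1%:Z = i - 1 by rewrite /i; lia.
have lij : i - 1 <= j by rewrite /i; lia.
have := mdet (i - 1) j; have := mdet (i - 1) (j - 1).
rewrite !subrK => h1 h2.
have {}h1 := h1 ltac:(lia); have {}h2 := h2 ltac:(lia).
have pos : m i j != 0 by rewrite gt_eqF // mpos.
apply: (mulfI pos).
transitivity (m (i - 1) j * (m (j + 1) (j + 1) * m i j)); last by ring.
rewrite -IH; lra.
Qed.

(** As functions of j, both sides satisfy the same second-order recurrence and start with 0, 1 at j
    = i - 2, i - 1. *)
Lemma frieze_vdet m x y : infinite_frieze m -> unimodular x y ->
  (forall i, m i i = vdet x y (i - 1) (i + 1)) ->
  forall i j, i - 2 <= j -> m i j = vdet x y (i - 1) (j + 1).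
Proof.
move=> fm uxy ang i j le_ij.
have [m0 m1 _ _] := fm.
have [t ->] : exists t : nat, j = i - 2 + t%:Z.
  by exists (absz (j - (i - 2))%R); lia.
suff [] : m i (i - 2 + t%:Z) = vdet x y (i - 1) (i - 2 + t%:Z + 1) /\
  m i (i - 2 + t%:Z + 1) = vdet x y (i - 1) (i - 2 + t%:Z + 1 + 1) by [].
elim: t => [|t [IH1 IH2]].
  have -> : i - 2 + 0%:Z + 1 = i - 1 by lia.
  by rewrite addr0 m0 m1 vdet_diag uxy.
have -> : i - 2 + t.+1%:Z = i - 2 + t%:Z + 1 by lia.
split=> //; set k := i - 2 + t%:Z + 1 in IH1 IH2 *.
have kB : k - 1 = i - 2 + t%:Z by rewrite /k; lia.
have := frieze_rec (j := k) fm (_ : i - 1 <= k); rewrite kB IH1 IH2 ang addrK.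
move=> /(_ ltac:(rewrite /k; lia)) h.
have := unimodular_vdet_rec (i - 1) (k + 1) uxy; rewrite addrK -h; lra.
Qed.

Lemma periodic_mulz (n : nat) (h : int -> int) :
  (forall j, h (j + n%:Z) = h j) -> forall k j, h (j + k * n%:Z) = h j.
Proof.
move=> ph k j; elim: k => [|k IH|k IH]; first by rewrite mul0r addr0.
  by rewrite -[RHS]IH -[RHS]ph; congr h; lia.
by rewrite -[RHS]IH -[LHS]ph; congr h; lia.
Qed.

Lemma periodic_eq (n : nat) (f g : int -> int) : (0 < n)%N ->
  (forall i, f (i + n%:Z) = f i) -> (forall i, g (i + n%:Z) = g i) ->
  (forall k : nat, (k < n)%N -> f k.+1%:Z = g k.+1%:Z) -> f =1 g.
Proof.
move=> n0 pf pg fg i.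
(* The shift by one makes r + 1 run over 1, ..., n, the indices covered by [fg]. *)
pose r := ((i - 1) %% n%:Z)%Z; pose k := ((i - 1) %/ n%:Z)%Z.
have e : i = r + 1 + k * n%:Z.
  by have := divz_eq (i - 1) n%:Z; rewrite -/r -/k; lia.
have r0 : 0 <= r by apply: modz_ge0; lia.
have rn : r < n%:Z by apply: ltz_pmod; lia.
rewrite e !periodic_mulz //.
have -> : r + 1 = (absz r).+1%:Z by lia.
by apply: fg; lia.
Qed.

(** Gives access to the frieze chosen by [epsilon]: one realization of [q] determines the relevant
    entries of every frieze with quiddity [q]. *)
Lemma realizes_frieze x y q m : realizes x y q -> frieze_with_quiddity q m ->
  forall i j, i - 2 <= j -> m i j = vdet x y (i - 1) (j + 1).
Proof.
case=> n0 uxy _ per ang [_ fm pm qm]; apply: frieze_vdet => //.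
apply: (@periodic_eq (size q) (fun i => m i i)
  (fun i => vdet x y (i - 1) (i + 1))) => // [i|i|k kn].
- by apply: pm; lia.
- by rewrite -[RHS]per; congr vdet; lia.
- by rewrite -qm // ang //; congr vdet; lia.
Qed.

(** The recurrence v_{i+1} = a_i v_i - v_{i-1} preserves det(v_i, v_{i+1}), which is 1 for the
    initial vectors (1, 0) and (0, 1). *)
Lemma quiddity_realizes q : quiddity_sequence q -> exists x y, realizes x y q.
Proof.
case=> m [n0 fm pm qm].
have [x [x0 x1 xr]] := second_order_solution (fun i => m i i) 1 0.
have [y [y0 y1 yr]] := second_order_solution (fun i => m i i) 0 1.
have step i : vdet x y i (i + 1) = vdet x y (i - 1) i.
  by rewrite /vdet xr yr; ring.
have uxy : unimodular x y.
  move=> i; elim: i => [|k IH|k IH].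
  - by rewrite /vdet add0r x0 x1 y0 y1.
  - by rewrite step -[RHS]IH; congr vdet; lia.
  - by rewrite -[RHS]IH [RHS]step; congr vdet; lia.
have E := frieze_vdet fm uxy; have [_ _ mpos _] := fm.
have {}E : forall i j, i - 2 <= j -> m i j = vdet x y (i - 1) (j + 1).
  apply: E => i; rewrite /vdet xr yr.
  have := uxy (i - 1); rewrite subrK /vdet => h.
  by rewrite -[LHS]mulr1 -[X in _ * X = _]h; ring.
have E' i j : i <= j -> vdet x y i j = m (i + 1) (j - 1).
  by move=> le_ij; rewrite E; [congr vdet; lia | lia].
exists x, y; split=> // [i j lt_ij|i j|k kn].
- by rewrite E'; [apply: mpos; lia | lia].
- have per i' j' : i' <= j' ->
    vdet x y (i' + (size q)%:Z) (j' + (size q)%:Z) = vdet x y i' j'.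
    move=> le_ij; rewrite !E' //; last by lia.
    by rewrite -[RHS]pm; [congr m; lia | lia].
  have [le_ij|lt_ji] := lerP i j; first exact: per.
  by rewrite vdet_anti per ?ltW // -vdet_anti.
- by rewrite qm // E; [congr vdet; lia | lia].
Qed.

Lemma realizes_quiddity x y q : realizes x y q -> quiddity_sequence q.
Proof.
case=> n0 uxy pos per ang; exists (fun i j => vdet x y (i - 1) (j + 1)).
split=> //; [split|..] => /= [i|i|i j le_ij|i j le_ij|i j _|k kn].
- have -> : i - 2 + 1 = i - 1 by lia.
  exact: vdet_diag.
- by rewrite subrK unimodularB.
- by apply: pos; lia.
(* Plücker relation for v_{i-1}, v_i, v_{j+1}, v_{j+2}, with det(v_{i-1}, v_i) = det(v_{j+1},
   v_{j+2}) = 1. *)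
- have := unimodularB i uxy; have := uxy (j + 1).
  rewrite addrK /vdet => e1 e2.
  by rewrite -[RHS]mulr1 -[X in _ = X * _]e1 -[X in _ = _ * X]e2; ring.
- by rewrite -[RHS]per; congr vdet; lia.
- by rewrite ang //; congr vdet; lia.
Qed.

Lemma s_of_realizes x y q : realizes x y q ->
  s_of q = vdet x y 0 ((size q)%:Z + 1) - vdet x y 1 (size q)%:Z.
Proof.
move=> h; have hq : frieze_with_quiddity q (frieze_of q).
  exact: (epsilon_spec _ _ (realizes_quiddity h)).
have [n0 _ _ _ _] := h.
(* For n = 1 the second entry is m_{2,0}, on the row of zeros, still within range. *)
rewrite /s_of !(realizes_frieze h hq); try lia.
by rewrite subrr subrK.
Qed.

(** * Rotation invariance of [s_of] *)

Definition s_preserving (q q' : seq int) : Prop :=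
  quiddity_sequence q -> quiddity_sequence q' /\ s_of q = s_of q'.

(** Rotations can be chained around a gluing or cutting because the conclusion of [s_preserving]
    includes being a quiddity sequence. *)
Lemma s_preserving_trans q2 q1 q3 :
  s_preserving q1 q2 -> s_preserving q2 q3 -> s_preserving q1 q3.
Proof. by move=> h12 h23 /h12[/h23[q3q e23] e12]; rewrite e12. Qed.

Lemma s_preserving_rot1 a u : s_preserving (a :: u) (rcons u a).
Proof.
move=> /quiddity_realizes[x [y h]]; have [n0 uxy pos per ang] := h.
pose x' j := x (j + 1); pose y' j := y (j + 1).
have E i j : vdet x' y' i j = vdet x y (i + 1) (j + 1) by [].
have h' : realizes x' y' (rcons u a).
  split; rewrite ?size_rcons //.
  - by move=> i; rewrite E.
  - by move=> i j lt_ij; rewrite E pos // ltrD2r.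
  - by move=> i j; rewrite !E -[RHS]per; congr vdet; rewrite /=; lia.
  - move=> k kn; rewrite E nth_rcons; have [lt_k|ge_k] := ltnP k (size u).
      by have /= -> := ang k.+1 lt_k; congr vdet; lia.
    have -> : k = size u by apply/eqP; rewrite eqn_leq ge_k andbT -ltnS.
    rewrite eqxx; have /= -> := ang 0%N n0.
    by rewrite -[LHS]per /=; congr vdet; lia.
split; first exact: realizes_quiddity h'.
rewrite (s_of_realizes h) (s_of_realizes h') !E size_rcons.
set n := (size (a :: u)); rewrite -/n in per.
(* By periodicity det(v_n, v_{n+2}) = det(v_0, v_2) = a_1, so det(v_1, v_{n+2}) + det(v_1, v_n) and
   det(v_2, v_{n+1}) + det(v_0, v_{n+1}) both equal a_1 det(v_1, v_{n+1}). *)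
have e1 := unimodular_vdet_rec 1 (n%:Z + 1) uxy.
have e2 := unimodular_vdet_rec (n%:Z + 1) 1 uxy.
have e3 := per 0 2.
have e4 := vdet_anti x y (n%:Z + 1) 1; have e5 := vdet_anti x y (n%:Z + 1) 0.
have e6 := vdet_anti x y (n%:Z + 1) 2.
rewrite addrK add0r in e1 e2 e3; rewrite subrr in e2.
have e7 : n%:Z + 1 + 1 = 2 + n%:Z by lia.
have e8 : (1 : int) + 1 = 2%:R by [].
rewrite add0r -[(size u).+1]/n e8 e7.
rewrite e7 e3 in e1; rewrite e8 e4 e5 e6 in e2.
lra.
Qed.

Lemma s_preserving_catC u v : s_preserving (u ++ v) (v ++ u).
Proof.
elim: u v => [|a u IH] v; first by rewrite cats0.
apply: (@s_preserving_trans (u ++ rcons v a)).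
  by rewrite -rcons_cat; apply: s_preserving_rot1.
by rewrite -cat_rcons; apply: IH.
Qed.

(* Gluing above (a_n, a_1), uniformly in n: for n = 1 both increments hit a_1. *)
Definition glued_end (q qh : seq int) : Prop :=
  [/\ size qh = (size q).+1, qh`_(size q) = 1
    & forall k : nat, (k < size q)%N ->
        qh`_k = q`_k + (k == 0%N)%:R + (k.+1 == size q)%:R].

(** * Insertion of mediants *)

Definition insert_mediants (f : int -> int) (e : int -> bool) (x : int -> int)
  (j : int) : int := x (f j) + (e j)%:R * x (f j + 1).

Lemma vdet_insert_mediants f e x y i j :
  vdet (insert_mediants f e x) (insert_mediants f e y) i j =
  vdet x y (f i) (f j) + (e j)%:R * vdet x y (f i) (f j + 1)
  + (e i)%:R * vdet x y (f i + 1) (f j)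
  + (e i)%:R * (e j)%:R * vdet x y (f i + 1) (f j + 1).
Proof. rewrite /vdet /insert_mediants; ring. Qed.

Section Insertion.
Variables (x y : int -> int) (f : int -> int) (e : int -> bool).
Hypothesis uxy : unimodular x y.
Hypothesis pos : forall i j, i < j -> 0 < vdet x y i j.
(** [f] gives the old index of the last original vector up to a position: it stalls exactly at the
    mediants, no two of which are adjacent. *)
Hypothesis fS : forall i, f (i + 1) = f i + (~~ e (i + 1))%:R.
Hypothesis eS : forall i, ~~ (e i && e (i + 1)).

(** det(v, v + w) = det(v + w, w) = det(v, w). *)
Lemma unimodular_insert_mediants :
  unimodular (insert_mediants f e x) (insert_mediants f e y).
Proof.
move=> i; rewrite vdet_insert_mediants fS.
have := eS i; case: (e i); case: (e (i + 1)) => //= _;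
  by rewrite ?addr0 ?mul0r ?mul1r ?vdet_diag ?uxy ?addr0 ?add0r.
Qed.

(** Bilinear expansion leaves only terms det(v_k, v_l) with k <= l, and the one with k = [f i], l =
    [f j + e j] has k < l. *)
Lemma insert_mediants_pos i j : i < j ->
  0 < vdet (insert_mediants f e x) (insert_mediants f e y) i j.
Proof.
have homo_f : {homo f : k l / k <= l}.
  move=> k l le_kl; have [t ->] : exists t : nat, l = k + t%:Z.
    by exists (absz (l - k)%R); lia.
  elim: t => [|t IH]; first by rewrite addr0.
  have -> : k + t.+1%:Z = k + t%:Z + 1 by lia.
  by rewrite fS; apply: le_trans IH _; rewrite lerDl.
have vdet_ge0 k l : k <= l -> 0 <= vdet x y k l.
  by rewrite le_eqVlt => /predU1P[->|/pos/ltW //]; rewrite vdet_diag.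
move=> lt_ij; have le_i1j : i + 1 <= j by lia.
have lef1 := homo_f _ _ le_i1j; have lef2 := homo_f i (j - 1) ltac:(lia).
have := fS i; have := eS i; have := fS (j - 1); have := eS (j - 1).
rewrite subrK => e1 f1 e2 f2; rewrite vdet_insert_mediants.
(* If j carries no mediant, [f] has just advanced at j; if i carries one, [f] advances at i + 1. *)
have lt1 : f i < f j + (e j)%:R by case: (e j) f1 => /= f1; lia.
have lt2 : f i + (e i)%:R <= f j.
  by case: (e i) (e (i + 1)) e2 f2 => -[] //= _ f2; lra.
case: (e j) lt1 => /= lt1; case: (e i) lt2 => /= lt2;
  rewrite ?mul0r ?mul1r ?addr0.
- have p1 : 0 < vdet x y (f i) (f j + 1) by apply: pos; lia.
  have p2 : 0 <= vdet x y (f i) (f j) by apply: vdet_ge0; lia.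
  have p3 : 0 <= vdet x y (f i + 1) (f j) by apply: vdet_ge0; lia.
  have p4 : 0 <= vdet x y (f i + 1) (f j + 1) by apply: vdet_ge0; lia.
  lra.
- have p1 : 0 < vdet x y (f i) (f j + 1) by apply: pos; lia.
  have p2 : 0 <= vdet x y (f i) (f j) by apply: vdet_ge0; lia.
  lra.
- have p1 : 0 < vdet x y (f i) (f j) by apply: pos; lia.
  have p2 : 0 <= vdet x y (f i + 1) (f j) by apply: vdet_ge0; lia.
  lra.
- by apply: pos; lia.
Qed.

End Insertion.

(** * Gluing above the last and first entries *)

Lemma divzS (d : int) (i : int) : 0 < d ->
  ((i + 1) %/ d)%Z = (i %/ d)%Z + (d %| i + 1)%Z%:R.
Proof.
move=> d0; have dn0 : d != 0 by rewrite gt_eqF.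
have -> : (d %| i + 1)%Z = (((i + 1) %% d)%Z == 0).
  by apply/dvdz_mod0P/eqP.
have e := divz_eq i d.
have r0 := modz_ge0 i dn0; have rd := ltz_pmod i d0.
rewrite {1 3}e -addrA divzMDl // modzMDl; congr (_ + _).
set r := (i %% d)%Z in r0 rd *.
have [lt_r|ge_r] := ltrP (r + 1) d.
  rewrite divz_small ?modz_small ?lt_r //; lia.
have -> : r + 1 = d by lia.
by rewrite divzz modzz dn0.
Qed.

(* v_{nk+r}, 1 <= r <= n, becomes the vector of index (n+1)k + r, and the indices
   divisible by n + 1 carry the mediants; [cut_index] below undoes this. *)
Definition glue_index (n : nat) (j : int) : int := j - (j %/ n.+1%:Z)%Z.

Definition glue_mediant (n : nat) (j : int) : bool := (n.+1%:Z %| j)%Z.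

Definition glue_vec (n : nat) (x : int -> int) : int -> int :=
  insert_mediants (glue_index n) (glue_mediant n) x.

Lemma glue_index_small (n k : nat) : (k <= n)%N -> glue_index n k%:Z = k%:Z.
Proof. by move=> le_kn; rewrite /glue_index divz_small ?subr0. Qed.

Lemma glue_indexD n (i : int) :
  glue_index n (i + n.+1%:Z) = glue_index n i + n%:Z.
Proof.
rewrite /glue_index (addrC i) -{2}[n.+1%:Z]mul1r divzMDl //; lia.
Qed.

Lemma glue_mediantD n (i : int) :
  glue_mediant n (i + n.+1%:Z) = glue_mediant n i.
Proof. by rewrite /glue_mediant rpredDr ?dvdzz. Qed.

Lemma glue_mediant_small (n k : nat) :
  (k <= n)%N -> glue_mediant n k%:Z = (k == 0%N).
Proof.
move=> le_kn; rewrite /glue_mediant dvdzE /=.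
by case: k le_kn => [|k] le_kn; rewrite ?dvdn0 // gtnNdvd.
Qed.

Lemma glue_indexS n (i : int) :
  glue_index n (i + 1) = glue_index n i + (~~ glue_mediant n (i + 1))%:R.
Proof.
by rewrite /glue_index divzS // -/(glue_mediant n (i + 1));
  case: glue_mediant => /=; lra.
Qed.

Lemma glue_mediantS n (i : int) :
  (0 < n)%N -> ~~ (glue_mediant n i && glue_mediant n (i + 1)).
Proof.
move=> n0; apply/negP => /andP[d1].
rewrite /glue_mediant rpredDl // dvdzE /= dvdn1.
by case: n n0 {d1}.
Qed.

Lemma glue_vec_small n x (k : nat) : (k <= n)%N ->
  glue_vec n x k%:Z = x k%:Z + (k == 0%N)%:R * x (k%:Z + 1).
Proof.
by move=> le_kn; rewrite /glue_vec /insert_mediants glue_index_small //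
  glue_mediant_small.
Qed.

Lemma glue_vec_large n x (k : nat) : (k <= n)%N ->
  glue_vec n x (k%:Z + n.+1%:Z) =
  x (k%:Z + n%:Z) + (k == 0%N)%:R * x (k%:Z + n%:Z + 1).
Proof.
by move=> le_kn; rewrite /glue_vec /insert_mediants glue_indexD
  glue_mediantD glue_index_small // glue_mediant_small.
Qed.

(** The mediant v_n + v_{n+1} has neighbours v_n, v_{n+1}, hence entry 1. As the new left neighbour
    of v_1, v_0 + v_1 raises a_1 by one; as the new right neighbour of v_n, the mediant raises a_n
    by one. *)
Lemma realizes_glue x y q qh : glued_end q qh -> realizes x y q ->
  realizes (glue_vec (size q) x) (glue_vec (size q) y) qh.
Proof.
case=> sz qhn qhk [n0 uxy pos per ang].
set n := size q in sz qhn qhk n0 per ang *.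
have fS := @glue_indexS n; have eS i := @glue_mediantS n i n0.
split; rewrite ?sz //.
- exact: unimodular_insert_mediants.
- by move=> i j; apply: insert_mediants_pos.
- move=> i j; rewrite !vdet_insert_mediants !glue_indexD !glue_mediantD per.
  by rewrite !(addrAC _ n%:Z) !per.
- move=> k; rewrite ltnS leq_eqVlt => /predU1P[->|lt_kn].
    have -> : n%:Z + 2 = 1%:Z + n.+1%:Z by lia.
    rewrite qhn /vdet !glue_vec_large // !glue_vec_small // (gtn_eqF n0) /=.
    by rewrite !mul0r !addr0 (addrC 1%:Z) -[LHS](uxy n%:Z).
  have E z : glue_vec n z (k%:Z + 2) =
      z (k%:Z + 2) + (k.+1 == n)%:R * z (k%:Z + 1).
    case: (eqVneq k.+1 n) => [eq_kn|ne_kn].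
      have -> : k%:Z + 2 = 0%:Z + n.+1%:Z by lia.
      rewrite glue_vec_large // add0r !mul1r addrC.
      by congr (z _ + z _); lia.
    have -> : k%:Z + 2 = k.+2%:Z by lia.
    by rewrite glue_vec_small ?mul0r ?addr0 //; lia.
  rewrite qhk // ang // /vdet !E !glue_vec_small //; try lia.
  have := uxy k%:Z; have := uxy (k%:Z + 1).
  have -> : k%:Z + 1 + 1 = k%:Z + 2 by lia.
  rewrite /vdet => e1 e2.
  (* Each increment is multiplied by a determinant equal to 1, which leaves a polynomial
     identity. *)
  rewrite -[X in _ + X + _ = _]mulr1 -[X in _ + _ + X = _]mulr1.
  rewrite -[X in _ + _ * X + _ = _]e1 -[X in _ + _ + _ * X = _]e2; ring.
Qed.

Lemma glued_end_s_preserving q qh : glued_end q qh -> s_preserving q qh.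
Proof.
move=> g /quiddity_realizes[x [y h]]; have h' := realizes_glue g h.
split; first exact: realizes_quiddity h'.
rewrite (s_of_realizes h) (s_of_realizes h').
have [-> _ _] := g; have [n0 _ _ _ _] := h; set n := size q in n0 *.
have E0 z : glue_vec n z 0 = z 0 + z 1.
  by rewrite (@glue_vec_small n z 0) // mul1r.
have E1 z : glue_vec n z 1 = z 1.
  by rewrite (@glue_vec_small n z 1) // mul0r addr0.
have E2 z : glue_vec n z n.+1%:Z = z n%:Z + z (n%:Z + 1).
  by have := @glue_vec_large n z 0 isT; rewrite !add0r mul1r.
have E3 z : glue_vec n z (n.+1%:Z + 1) = z (n%:Z + 1).
  by rewrite addrC (@glue_vec_large n z 1) // mul0r addr0 addrC.
rewrite /vdet !E0 !E1 !E2 !E3; ring.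
Qed.

(** * Cutting above the last entry *)

Definition cut_index (n : nat) (j : int) : int := j + ((j - 1) %/ n%:Z)%Z.

(** [cut_index] enumerates increasingly the integers not divisible by n + 1, so it jumps by 2 across
    each deleted index. *)
Lemma cut_indexS n (i : int) : (0 < n)%N ->
  cut_index n (i + 1) = cut_index n i + 1 + (n%:Z %| i)%Z%:R.
Proof.
move=> n0; have := @divzS n%:Z (i - 1) n0; rewrite subrK => e.
by rewrite /cut_index addrK e; lra.
Qed.

Lemma cut_indexD n (i k : int) : (0 < n)%N ->
  cut_index n (i + k * n%:Z) = cut_index n i + k * n.+1%:Z.
Proof.
move=> n0; rewrite /cut_index.
have -> : i + k * n%:Z - 1 = k * n%:Z + (i - 1) by ring.
by rewrite divzMDl ?gt_eqF // -addn1 PoszD; ring.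
Qed.

Lemma cut_index_small (n k : nat) :
  (0 < k)%N -> (k <= n)%N -> cut_index n k%:Z = k%:Z.
Proof. by move=> k0 le_kn; rewrite /cut_index divz_small ?addr0 //; lia. Qed.

Lemma cut_index0 n : (0 < n)%N -> cut_index n 0 = -1.
Proof.
move=> n0; have := @cut_indexS n 0 n0.
by rewrite add0r (@cut_index_small n 1) // dvdz0 /=; lia.
Qed.

Lemma cut_indexS_size n : (0 < n)%N -> cut_index n (n%:Z + 1) = n%:Z + 2.
Proof.
by move=> n0; rewrite cut_indexS // cut_index_small // dvdzz /=; lia.
Qed.

(** Each deleted vector has entry 1, so it is the sum of its neighbours, and their determinant is 1.
    Positivity survives because [cut_index] is increasing. *)
Lemma realizes_cut x y q qh : glued_end q qh -> (0 < size q)%N ->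
  realizes x y qh ->
  realizes (x \o cut_index (size q)) (y \o cut_index (size q)) q.
Proof.
case=> sz qhn qhk n0 [_ uxy pos per ang]; set n := size q in sz qhn qhk n0 *.
rewrite sz in per ang.
have E i j : vdet (x \o cut_index n) (y \o cut_index n) i j =
  vdet x y (cut_index n i) (cut_index n j) by [].
have angn i : (n%:Z %| i)%Z -> vdet x y (cut_index n i) (cut_index n i + 2) = 1.
  case/dvdzP=> t ->; rewrite -[t * _]add0r cut_indexD // cut_index0 //.
  pose h j := vdet x y j (j + 2).
  have ph j : h (j + n.+1%:Z) = h j by rewrite /h -[RHS]per; congr vdet; lia.
  rewrite -/(h _) (periodic_mulz ph) -ph -[RHS]qhn ang //.
  by rewrite /h; congr vdet; lia.
split=> //.
- move=> i; rewrite E cut_indexS //; case: (boolP (n%:Z %| i)%Z) => [d|_] /=.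
    by rewrite -addrA angn.
  by rewrite addr0 uxy.
- move=> i j lt_ij; rewrite E; apply: pos.
  have [t ->] : exists t : nat, j = i + 1 + t%:Z.
    by exists (absz (j - i - 1)%R); lia.
  elim: t => [|t IH]; first by rewrite addr0 cut_indexS //; lia.
  have -> : i + 1 + t.+1%:Z = i + 1 + t%:Z + 1 by lia.
  by rewrite cut_indexS //; lia.
- move=> i j; rewrite !E -(mul1r n%:Z) !cut_indexD // !mul1r.
  exact: per.
- move=> k lt_kn; rewrite E.
  (* [z] stands for either coordinate. With v_0 deleted, the left neighbour of v_1 is v_{-1} = v_0 -
     v_1; in [E1], the right neighbour of v_n is v_{n+2} = v_{n+1} - v_n. *)
  have E0 z :
      (forall i, z (i + 1) + z (i - 1) = vdet x y (i - 1) (i + 1) * z i) ->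
      z (cut_index n k%:Z) = z k%:Z - (k == 0%N)%:R * z (k%:Z + 1).
    move=> zr; case: (eqVneq k 0%N) => [->|k0]; last first.
      by rewrite cut_index_small ?lt0n ?mul0r ?subr0 // ltnW.
    have := zr 0; rewrite -[Posz 0]/(0 : int) cut_index0 // add0r sub0r.
    have -> : vdet x y (-1) 1 = 1.
      have := angn 0 (dvdz0 _); rewrite cut_index0 // => <-; congr vdet; lia.
    by rewrite !mul1r; lra.
  have E1 z :
      (forall i, z (i + 1) + z (i - 1) = vdet x y (i - 1) (i + 1) * z i) ->
      z (cut_index n (k%:Z + 2)) =
      z (k%:Z + 2) - (k.+1 == n)%:R * z (k%:Z + 1).
    move=> zr; case: (eqVneq k.+1 n) => [eq_kn|ne_kn]; last first.
      have -> : k%:Z + 2 = k.+2%:Z by lia.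
      by rewrite cut_index_small ?mul0r ?subr0 //; lia.
    have -> : k%:Z + 2 = n%:Z + 1 by lia.
    have -> : k%:Z + 1 = n%:Z by lia.
    have := zr (n%:Z + 1); rewrite cut_indexS_size // addrK.
    have -> : n%:Z + 1 + 1 = n%:Z + 2 by lia.
    by rewrite -ang // qhn !mul1r; lra.
  have xr i := unimodular_recl i uxy; have yr i := unimodular_recr i uxy.
  have := qhk k lt_kn; rewrite (ang k (ltnW lt_kn)).
  rewrite /vdet (E0 x xr) (E0 y yr) (E1 x xr) (E1 y yr) => ek.
  have := uxy k%:Z; have := uxy (k%:Z + 1).
  have -> : k%:Z + 1 + 1 = k%:Z + 2 by lia.
  rewrite /vdet => e1 e2.
  move: (q`_k) ek => c; set A := (k == 0%N)%:R; set B := (k.+1 == n)%:R => ek.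
  have -> : c = x k%:Z * y (k%:Z + 2) - x (k%:Z + 2) * y k%:Z - A * 1 - B * 1.
    by rewrite ek; ring.
  by rewrite -[X in A * X]e1 -[X in B * X]e2; ring.
Qed.

(** * Reduction of all gluings and cuttings to the end of the list *)

Lemma glued_end_one a : glued_end [:: a] [:: a + 2; 1].
Proof. by split=> // -[] //= _; rewrite -addrA. Qed.

Lemma glued_end_cat a u b :
  glued_end (a :: u ++ [:: b]) (a + 1 :: u ++ [:: b + 1; 1]).
Proof.
split; rewrite /= ?size_cat /= ?addn1 ?addn2 //.
  by rewrite nth_cat ltnNge leqnSn /= subSnn.
case=> [_|k]; rewrite ?ltnS /=; first by rewrite addr0.
rewrite leq_eqVlt => /predU1P[->|lt_k].
  by rewrite !nth_cat ltnn subnn eqxx /= addr0.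
by rewrite !nth_cat lt_k !eqSS ltn_eqF //= !addr0.
Qed.

(** Once [realizes_cut] shows that [q] is a quiddity sequence, the equality is that of the gluing
    from [q] to [qh], read backwards. *)
Lemma glued_end_cut_s_preserving q qh :
  glued_end q qh -> (0 < size q)%N -> s_preserving qh q.
Proof.
move=> g n0 /quiddity_realizes[x [y h]].
have qq := realizes_quiddity (realizes_cut g n0 h).
by split=> //; have [_ ->] := glued_end_s_preserving g qq.
Qed.

Lemma gluing_s_preserving q qh : gluing q qh -> s_preserving q qh.
Proof.
case=> [a|u a b v|a u b].
- exact/glued_end_s_preserving/glued_end_one.
(* Rotate so that b comes first and a last, glue there, and rotate back. *)
- apply: (@s_preserving_trans ((b :: v) ++ (u ++ [:: a]))).
    by rewrite (_ : u ++ [:: a; b] ++ v = (u ++ [:: a]) ++ b :: v);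
      [apply: s_preserving_catC | rewrite -catA].
  apply: (@s_preserving_trans ((b + 1 :: v) ++ (u ++ [:: a + 1; 1]))).
    apply: glued_end_s_preserving.
    by have := @glued_end_cat b (v ++ u) a; rewrite /= -!catA.
  by rewrite (_ : u ++ _ ++ v = (u ++ [:: a + 1; 1]) ++ b + 1 :: v);
    [apply: s_preserving_catC | rewrite -catA].
- exact/glued_end_s_preserving/glued_end_cat.
Qed.

(** Up to rotation the entry 1 is last, and its cutting inverts a gluing at the end: [cut2] for
    length 2, [cut3] for greater length. *)
Lemma cutting_s_preserving q qc : cutting q qc -> s_preserving q qc.
Proof.
have cut2 (a : int) : s_preserving [:: a; 1] [:: a - 2].
  apply: glued_end_cut_s_preserving => //.
  by have := glued_end_one (a - 2); rewrite subrK.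
have cut3 (b : int) u (a : int) :
    s_preserving (b :: u ++ [:: a; 1]) (b - 1 :: u ++ [:: a - 1]).
  apply: glued_end_cut_s_preserving => //.
  by have := glued_end_cat (b - 1) u (a - 1); rewrite !subrK.
case=> [a|a|u a b v|b u a|b u a] //.
- apply: (@s_preserving_trans [:: a; 1]); last exact: cut2.
  exact: (@s_preserving_rot1 _ [:: a]).
- apply: (@s_preserving_trans ((b :: v) ++ (u ++ [:: a; 1]))).
    by rewrite (_ : u ++ _ ++ v = (u ++ [:: a; 1]) ++ b :: v);
      [apply: s_preserving_catC | rewrite -catA].
  apply: (@s_preserving_trans ((b - 1 :: v) ++ (u ++ [:: a - 1]))).
    by have := cut3 b (v ++ u) a; rewrite /= -!catA.
  by rewrite (_ : u ++ _ ++ v = (u ++ [:: a - 1]) ++ b - 1 :: v);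
    [apply: s_preserving_catC | rewrite -catA].
- apply: s_preserving_trans (@s_preserving_rot1 _ (b :: u ++ [:: a])) _.
  by have := cut3 b u a; rewrite /= rcons_cat.
Qed.

Theorem theorem3p1 (q : seq int) (hq : quiddity_sequence q) :
  (forall qhat : seq int, gluing q qhat -> s_of q = s_of qhat) /\
  (forall qcheck : seq int, cutting q qcheck -> s_of q = s_of qcheck).
Proof.
by split=> q' => [/gluing_s_preserving|/cutting_s_preserving] /(_ hq) [].
Qed.
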